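(* Let $\alpha\in\mathbb R$, $\kappa\in\mathbb R$, let $\mathrm{Dom}_\alpha$ be as in the context, and assume that the function $\Gamma:\mathrm{Dom}_\alpha\to\mathbb R_{>0}$ is decreasing, continuously differentiable and satisfies $$\left[(\alpha-1)(v-\kappa)+1\right](\log\Gamma)'(v)+1\ge 0,\qquad v\in\mathrm{Dom}_\alpha .$$ Let $\mu\in \mathrm M_1(\mathsf T)$ be such that $\mu(\Gamma(b_{\mu,\alpha}+\kappa))<\infty$ and $\Psi_\alpha(\mu)<\infty$. Then: (i) $\Psi_\alpha(\mathcal I_\alpha(\mu))\le \Psi_\alpha(\mu)$; (ii) $\Psi_\alpha(\mathcal I_\alpha(\mu))=\Psi_\alpha(\mu)$ if and only if $\mu=\mathcal I_\alpha(\mu)$.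
   Context: Setting. $(\mathsf T,\mathcal T)$ is a measurable space and $\mathrm M_1(\mathsf T)$ is the set of probability measures on it. $(\mathsf Y,\mathcal Y,\nu)$ is a measured space with $\nu$ $\sigma$-finite. $k$ is a kernel density on $\mathsf T\times\mathsf Y$, i.e. $K(\theta,A)=\int_A k(\theta,y)\,\nu(dy)$ is a Markov transition kernel on $\mathsf T\times\mathcal Y$. $p$ is a measurable function on $\mathsf Y$. It is assumed that $k(\theta,y)>0$ and $p(y)>0$ for all $(\theta,y)\in\mathsf T\times\mathsf Y$, and $\int_{\mathsf Y}p(y)\,\nu(dy)<\infty$. On $(0,\infty)$: $f_0(u)=u-1-\log u$, $f_1(u)=1-u+u\log u$, and $f_\alpha(u)=\frac{1}{\alpha(\alpha-1)}[u^\alpha-1-\alpha(u-1)]$ for $\alpha\in\mathbb R\setminus\{0,1\}$. For $\mu\in\mathrm M_1(\mathsf T)$: $\mu k(y)=\int_{\mathsf T}\mu(d\theta)k(\theta,y)$; $\Psi_\alpha(\mu)=\int_{\mathsf Y}f_\alpha\left(\frac{\mu k(y)}{p(y)}\right)p(y)\,\nu(dy)$; $b_{\mu,\alpha}(\theta)=\int_{\mathsf Y}k(\theta,y)f_\alpha'\left(\frac{\mu k(y)}{p(y)}\right)\nu(dy)$. When $\alpha=1$ it is assumed that $b_{\mu,1}(\theta)$ is finite for all $\mu\in\mathrm M_1(\mathsf T)$ and $\theta\in\mathsf T$. For a function $h$, $\mu(h)=\int h\,d\mu$. $\mathrm{Dom}_\alpha$ is an interval of $\mathbb R$ such that for all $\theta\in\mathsf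 T$ and all $\mu\in\mathrm M_1(\mathsf T)$, $b_{\mu,\alpha}(\theta)+\kappa\in\mathrm{Dom}_\alpha$ and $\mu(b_{\mu,\alpha})+\kappa\in\mathrm{Dom}_\alpha$. $\mathcal I_\alpha(\mu)$ is the probability measure $\mathcal I_\alpha(\mu)(d\theta)=\frac{\mu(d\theta)\,\Gamma(b_{\mu,\alpha}(\theta)+\kappa)}{\mu(\Gamma(b_{\mu,\alpha}+\kappa))}$. *)

(* Defs.v *)
From HB Require Import structures.
From mathcomp Require Import all_boot all_order all_algebra.
From mathcomp Require Import all_classical all_reals all_analysis.
From mathcomp Require Import measurable_realfun.

Set Implicit Arguments.
Unset Strict Implicit.
Unset Printing Implicit Defensive.
Import Order.TTheory GRing.Theory Num.Theory.
Import numFieldNormedType.Exports.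

Local Open Scope classical_set_scope.
Local Open Scope ring_scope.

Section calculus_on_an_interval.
Context {R : realType}.
Implicit Types (D : set R) (f : R -> R) (x l : R).

(* The difference quotient only uses points of D, so that at an endpoint
   belonging to D the derivative is one-sided. *)
Definition is_derivative_within D f x l : Prop :=
  (f y - f x) / (y - x) @[y --> within D x^'] --> l.

Definition C1_on D f : Prop :=
  exists2 df : R -> R, (forall x, D x -> is_derivative_within D f x (df x)) &
                       {within D, continuous df}.

End calculus_on_an_interval.

Section alpha_divergence.
Context {R : realType}.

(* Only meaningful on u > 0. *)
Definition falpha (alpha u : R) : R :=
  if alpha == 0 then u - 1 - ln u
  else if alpha == 1 then 1 - u + u * ln u
  else (alpha * (alpha - 1))^-1 * (u `^ alpha - 1 - alpha * (u - 1)).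

Context {dT dY : measure_display}
  {T : measurableType dT} {Y : measurableType dY}.
Implicit Types (nu : {measure set Y -> \bar R}) (k : T -> Y -> R) (p : Y -> R)
  (mu : probability T R).

(* As the integral of mu k against nu is 1, mu k is infinite on a nu-null set
   only. There, the real-valued integral is 0, which does not affect the
   integrals against nu below. *)
Definition mixture mu k (y : Y) : R := \int[mu]_theta k theta y.

Definition Psi nu k p (alpha : R) mu : \bar R :=
  (\int[nu]_y (falpha alpha (mixture mu k y / p y) * p y)%:E)%E.

Definition balpha nu k p (alpha : R) mu (theta : T) : \bar R :=
  (\int[nu]_y (k theta y * derive1 (falpha alpha) (mixture mu k y / p y))%:E)%E.

End alpha_divergence.

Section reweighting.
Local Open Scope ereal_scope.
Context {d : measure_display} {T : measurableType d} {R : realType}.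
Context (mu : {measure set T -> \bar R}) (g : T -> R).

(* g(x) mu(dx); the guard makes this a measure for every function g. *)
Definition weighted (A : set T) : \bar R :=
  if `[< measurable_fun [set: T] g /\ forall x, (0 <= g x)%R >]
  then \int[mu]_(x in A) (g x)%:E else 0.

Let weighted0 : weighted set0 = 0.
Proof. by rewrite /weighted; case: ifP => // _; rewrite integral_set0. Qed.

Let weighted_ge0 A : 0 <= weighted A.
Proof.
rewrite /weighted; case: ifP => // /asboolP[_ g0].
by apply: integral_ge0 => x _; rewrite lee_fin.
Qed.

Let weighted_sigma_additive : semi_sigma_additive weighted.
Proof.
rewrite /weighted; case: asboolP => [[mg g0]|_].
  apply: semi_sigma_additive_nng_induced; last by move=> x; rewrite lee_fin.
  by apply/measurable_EFinP.
exact: (measure_semi_sigma_additive (s := mzero)).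
Qed.

HB.instance Definition _ := isMeasure.Build _ _ _ weighted
  weighted0 weighted_ge0 weighted_sigma_additive.

End reweighting.

Section iteration.
Context {R : realType} {dT : measure_display} {T : measurableType dT}.

(* g(x) mu(dx) / mu(g); [mnormalize] falls back on mu if mu(g) is 0 or
   infinite. *)
Definition reweight (mu : probability T R) (g : T -> R) : probability T R :=
  mnormalize (weighted mu g) mu.

Lemma reweightE (mu : probability T R) (g : T -> R) (A : set T) :
    measurable_fun [set: T] g -> (forall x, 0 < g x) ->
    (\int[mu]_x (g x)%:E < +oo)%E -> measurable A ->
  reweight mu g A =
    (\int[mu]_(x in A) (g x)%:E * (\int[mu]_x g x)^-1%:E)%E.
Proof.
move=> mg g0 gfin mA.
have wE B : weighted mu g B = (\int[mu]_(x in B) (g x)%:E)%E.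
  by rewrite /weighted; case: asboolP => // -[]; split => // x; exact: ltW.
have ig0 : (0 < \int[mu]_x (g x)%:E)%E.
  rewrite lt0e integral_ge0 ?andbT; last by move=> x _; rewrite lee_fin ltW.
  apply/eqP => ig.
  have igabs : (\int[mu]_x `|(g x)%:E| = 0)%E.
    by rewrite -ig; apply: eq_integral => x _; rewrite /= ger0_norm// ltW.
  have mgE : measurable_fun [set: T] (EFin \o g) by apply/measurable_EFinP.
  have [N [mN N0 NT]] := (ae_eq_integral_abs mu measurableT mgE).1 igabs.
  have : (mu [set: T] <= mu N)%E.
    apply: le_measure; rewrite ?inE// => x _; apply: NT => /= /(_ Logic.I) [].
    by apply/eqP; rewrite gt_eqF.
  by rewrite [leRHS]N0 probability_setT lee_fin ler10.
by rewrite /reweight /= /mnormalize /= wE (gt_eqF ig0) (lt_eqF gfin) /= wE.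
Qed.

Context {dY : measure_display} {Y : measurableType dY}.

Definition Ialpha (nu : {measure set Y -> \bar R}) (k : T -> Y -> R)
    (p : Y -> R) (alpha kappa : R) (Gamma : R -> R) (mu : probability T R) :
    probability T R :=
  reweight mu (fun theta => Gamma (fine (balpha nu k p alpha mu theta) + kappa)).

End iteration.

(* Main.v *)
(* Let g = Gamma (b + kappa) / mu (Gamma (b + kappa)), so that I mu = g mu, and
   let u = mu k / p. The tangent inequality
     f(u) >= f(g u) + f'(g u) (1 - g) u
   integrated against k / u mu(dtheta) nu(dy), followed by Jensen's inequality in
   theta, gives Psi(I mu) + A <= Psi(mu) with A the integral of k f'(g u) (1 - g).
   Since f'(g u) = g^(alpha - 1) f'(u) + f'(g), integrating over y first makes A
   the mean of (1 - g) (g^(alpha - 1) b + f'(g)). The hypothesis on log Gamma says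
   that the second factor is a nondecreasing function of b, and so is 1 - g, which
   has mean zero; hence A >= 0. If Psi(I mu) = Psi(mu), the tangent inequality is
   almost everywhere an equality, and strict convexity forces g = 1. *)
Require Import Defs.
From HB Require Import structures.
From mathcomp Require Import all_boot all_order all_algebra.
From mathcomp Require Import all_classical all_reals all_analysis.
From mathcomp Require Import measurable_realfun ring lra.
Set Implicit Arguments.
Unset Strict Implicit.
Unset Printing Implicit Defensive.
Import Order.TTheory GRing.Theory Num.Theory.
Import numFieldNormedType.Exports.
Local Open Scope classical_set_scope.
Local Open Scope ring_scope.

(** * Calculus of [falpha]: derivative, strict convexity, tangent inequality *)

Section falpha_calculus.
Context {R : realType}.
Implicit Types alpha u v a b g : R.

(** The case alpha = 0 fits the second formula: (u^-1 - 1) / (-1) = 1 - 1/u is the derivative of u -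
    1 - ln u. *)
Definition dfalpha alpha u : R :=
  if alpha == 1 then ln u else (u `^ (alpha - 1) - 1) / (alpha - 1).

Lemma is_derive_falpha alpha u : 0 < u ->
  is_derive u 1 (falpha alpha) (dfalpha alpha u).
Proof.
move=> u0; have dl := is_derive1_ln u0.
have un0 : u != 0 by rewrite gt_eqF.
have [->|a0] := eqVneq alpha 0.
  rewrite (_ : falpha 0 = fun x => x - 1 - ln x); last first.
    by apply/funext => x; rewrite /falpha eqxx.
  apply: is_derive_eq.
  rewrite /dfalpha eq_sym oner_eq0 sub0r powR_inv1 ?ltW//.
  by field.
have [->|a1] := eqVneq alpha 1.
  rewrite (_ : falpha 1 = fun x => 1 - x + x * ln x); last first.
    by apply/funext => x; rewrite /falpha oner_eq0 eqxx.
  apply: is_derive_eq.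
  rewrite /dfalpha eqxx /GRing.scale/=.
  by field.
have dp := @is_derive1_powR R alpha u u0.
rewrite (_ : falpha alpha = fun x =>
    (alpha * (alpha - 1))^-1 * (x `^ alpha - 1 - alpha * (x - 1))); last first.
  by apply/funext => x; rewrite /falpha (negbTE a0) (negbTE a1).
apply: is_derive_eq.
rewrite /dfalpha (negbTE a1) /GRing.scale/=.
by field; rewrite a0 subr_eq0 a1.
Qed.

Lemma derive1_falpha alpha u : 0 < u ->
  derive1 (falpha alpha) u = dfalpha alpha u.
Proof.
by move=> u0; rewrite derive1E; have [_ ->] := is_derive_falpha alpha u0.
Qed.

(** Powers are multiplicative and ln is additive. This separates a weight g depending on theta from
    a ratio u depending on y, so that the integral over y can be computed. *)
Lemma dfalphaM alpha g u : 0 < g -> 0 < u ->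
  dfalpha alpha (g * u) = g `^ (alpha - 1) * dfalpha alpha u + dfalpha alpha g.
Proof.
move=> g0 u0; rewrite /dfalpha; have [->|a1] := eqVneq alpha 1.
  by rewrite subrr powRr0 mul1r lnM// addrC.
by rewrite powRM ?ltW//; field; rewrite subr_eq0.
Qed.

(** Strict convexity of [falpha]. For alpha < 1 the power decreases, but the factor 1 / (alpha - 1)
    is negative and restores the order. *)
Lemma dfalpha_lt alpha u v : 0 < u -> u < v -> dfalpha alpha u < dfalpha alpha v.
Proof.
move=> u0 uv; have v0 := lt_trans u0 uv.
rewrite /dfalpha; have [_|a1] := eqVneq alpha 1; first by rewrite ltr_ln// posrE.
rewrite -subr_gt0 -mulrBl.
have [alt1|agt1] := ltP alpha 1.
  rewrite nmulr_lgt0 ?invr_lt0 ?subr_lt0//.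
  have -> : alpha - 1 = - (1 - alpha) by rewrite opprB.
  rewrite !powRN ltrD2r ltf_pV2 ?posrE ?powR_gt0//.
  by rewrite gt0_ltr_powR ?subr_gt0 ?nnegrE ?ltW.
have {}agt1 : 1 < alpha by rewrite lt_neqAle eq_sym a1.
by rewrite pmulr_lgt0 ?invr_gt0 ?subr_gt0// ltrD2r gt0_ltr_powR ?subr_gt0 ?nnegrE ?ltW.
Qed.

(** The slope of the chord is the derivative at a point strictly between a and b, which [dfalpha_lt]
    compares with the slope at b. *)
Lemma falpha_tangent_lt alpha a b : 0 < a -> 0 < b -> a != b ->
  falpha alpha b + dfalpha alpha b * (a - b) < falpha alpha a.
Proof.
move=> a0 b0.
have cf x y : 0 < x -> {within `[x, y], continuous (falpha alpha)}.
  move=> x0; apply: derivable_within_continuous => z.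
  rewrite in_itv/= => /andP[xz _].
  by have [] := is_derive_falpha alpha (lt_le_trans x0 xz).
have mvt x y : 0 < x -> x < y ->
    exists2 c, c \in `]x, y[ &
      falpha alpha y - falpha alpha x = dfalpha alpha c * (y - x).
  move=> x0 xy; apply: MVT => //; last exact: cf.
  move=> z; rewrite in_itv/= => /andP[xz _].
  exact: is_derive_falpha (lt_trans x0 xz).
move=> ab; have [{}ab|ba] : a < b \/ b < a.
  by case: ltgtP ab => //; [left|right].
- have [c] := mvt _ _ a0 ab; rewrite in_itv/= => /andP[ac cb] E.
  have := dfalpha_lt alpha (lt_trans a0 ac) cb; move: E; nra.
- have [c] := mvt _ _ b0 ba; rewrite in_itv/= => /andP[bc ca] E.
  have := dfalpha_lt alpha b0 bc; move: E; nra.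
Qed.

Lemma falpha_tangent_le alpha a b : 0 < a -> 0 < b ->
  falpha alpha b + dfalpha alpha b * (a - b) <= falpha alpha a.
Proof.
move=> a0 b0; have [->|ab] := eqVneq a b; first by rewrite subrr mulr0 addr0.
exact/ltW/falpha_tangent_lt.
Qed.

(** The tangent at 1 is the zero function, as [falpha] and its derivative vanish there. *)
Lemma falpha_ge0 alpha a : 0 < a -> 0 <= falpha alpha a.
Proof.
move=> a0; apply: le_trans (falpha_tangent_le alpha a0 ltr01).
rewrite /dfalpha /falpha ln1 !powR1; case: ifPn => [/eqP->|_].
  by rewrite eq_sym oner_eq0; lra.
by case: ifPn => _; lra.
Qed.

(* The exponential variable gives the derivative one formula for all alpha. *)
Lemma is_derive_dfalpha_expR alpha a :
  is_derive a 1 (dfalpha alpha \o expR) (expR ((alpha - 1) * a)).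
Proof.
have [->|a1] := eqVneq alpha 1.
  rewrite (_ : _ \o _ = id); last first.
    by apply/funext => x; rewrite /= /dfalpha eqxx expRK.
  by rewrite subrr mul0r expR0; exact: is_derive_id.
rewrite (_ : _ \o _ = fun x => (expR ((alpha - 1) * x) - 1) / (alpha - 1)).
  apply: is_derive_eq.
  by rewrite /GRing.scale/=; field; rewrite subr_eq0.
apply/funext => x.
by rewrite /= /dfalpha (negbTE a1) [_ * x]mulrC expRM.
Qed.

Lemma measurable_falpha alpha : measurable_fun [set: R] (falpha alpha).
Proof.
rewrite /falpha; case: (alpha == 0).
  apply: measurable_funB; last exact: measurable_ln.
  exact: measurable_funB.
case: (alpha == 1).
  apply: measurable_funD; first exact: measurable_funB.
  by apply: measurable_funM => //; exact: measurable_ln.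
apply: measurable_funM => //; apply: measurable_funB.
  by apply: measurable_funB => //; exact: measurable_powR.
by apply: measurable_funM => //; exact: measurable_funB.
Qed.

Lemma measurable_dfalpha alpha : measurable_fun [set: R] (dfalpha alpha).
Proof.
rewrite /dfalpha; case: (alpha == 1); first exact: measurable_ln.
apply: measurable_funM => //.
by apply: measurable_funB => //; exact: measurable_powR.
Qed.

End falpha_calculus.

(** * Derivatives relative to a set *)

Section calculus_within_an_interval.
Context {R : realType}.
Implicit Types (D : set R) (f : R -> R) (x l : R).

(** Carathéodory's form of the derivative: extending the quotient by l at x turns the limit over a
    punctured neighbourhood into one over a full neighbourhood. *)
Lemma is_derivative_within_caratheodory D f x l : is_derivative_within D f x l ->
  exists q : R -> R, [/\ forall y, f y - f x = q y * (y - x), q x = l &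
    q y @[y --> within D (nbhs x)] --> l].
Proof.
move=> dfx; exists (fun y => if y == x then l else (f y - f x) / (y - x)).
split; [| by rewrite eqxx |].
- move=> y; case: eqVneq => [->|yx]; first by rewrite !subrr mulr0.
  by rewrite divfK// subr_eq0.
- move=> U Ul; have := dfx U Ul; rewrite /= /nbhs/= => dfU.
  have {dfU} : \forall y \near x, y != x -> D y -> U ((f y - f x) / (y - x)).
    have : \forall y \near x^', D y -> U ((f y - f x) / (y - x)) by [].
    by rewrite near_withinE.
  move=> dfU; change (\forall y \near within D (nbhs x),
    U (if y == x then l else (f y - f x) / (y - x))).
  rewrite near_withinE; near=> y; case: eqVneq => [_ _|yx Dy].
    exact: nbhs_singleton.
  by move: yx Dy; near: y.
Unshelve. all: by end_near. Qed.

Lemma is_derivative_within_continuous D f :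
  (forall x, D x -> exists l, is_derivative_within D f x l) ->
  {within D, continuous f}.
Proof.
move=> df; apply/subspace_continuousP => x Dx.
have [l /is_derivative_within_caratheodory[q [qE _ ql]]] := df x Dx.
suff : q y * (y - x) + f x @[y --> within D (nbhs x)] --> l * (x - x) + f x.
  by under eq_fun do rewrite -qE subrK; rewrite subrr mulr0 add0r.
apply: cvgD; last exact: cvg_cst.
apply: cvgM => //; apply: cvgB; last exact: cvg_cst.
exact: cvg_within.
Qed.

Lemma is_derivative_within_interior D f x l : nbhs x D ->
  is_derivative_within D f x l -> is_derive x 1 f l.
Proof.
move=> xD /is_derivative_within_caratheodory[q [qE <- ql]].
apply/is_derive1_caratheodory; exists q; split => //.
move: ql; rewrite /within/= => ql.
by move=> U /ql; rewrite /nbhs/=; apply: filterS2 xD => y Dy /(_ Dy).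
Qed.

End calculus_within_an_interval.

(** * Monotonicity of the gradient under the hypothesis on log Gamma *)

Section reweighted_gradient.
Context {R : realType}.
Variables (alpha kappa : R) (Dom : interval R) (Gamma dlogGamma : R -> R).
Hypothesis Gamma_gt0 : forall v, v \in Dom -> 0 < Gamma v.
Hypothesis Gamma_decr : {in Dom &, nonincreasing_fun Gamma}.
Hypothesis Gamma_cont : {within [set` Dom], continuous Gamma}.
Hypothesis dlogGammaE : forall v, v \in Dom ->
  is_derivative_within [set` Dom] (fun w => ln (Gamma w)) v (dlogGamma v).
Hypothesis Gamma_ineq : forall v, v \in Dom ->
  0 <= ((alpha - 1) * (v - kappa) + 1) * dlogGamma v + 1.
Variable M : R.
Hypothesis M_gt0 : 0 < M.

Let sub_Dom x y : x \in Dom -> y \in Dom -> [set` `[x, y]] `<=` [set` Dom].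
Proof.
move=> xD yD z /=; rewrite in_itv/= => xzy.
exact: (@interval_is_interval _ Dom x y).
Qed.

(* With g = Gamma v / M, this is the integral of k f_alpha'(g mu k / p)
   when v = b + kappa. *)
Definition reweighted_gradient v : R :=
  (Gamma v / M) `^ (alpha - 1) * (v - kappa) + dfalpha alpha (Gamma v / M).

Let continuous_comp_cvg (F : set_system R) (f g : R -> R) a : Filter F ->
  {for a, continuous f} -> g x @[x --> F] --> a -> f (g x) @[x --> F] --> f a.
Proof. by move=> FF cf cg; apply: (@cvg_comp _ _ _ g f _ _ _ cg cf). Qed.

(** With L = ln (Gamma / M) the function reads e^((alpha - 1) L) (v - kappa) + f'(e^L). Its
    derivative is e^((alpha - 1) L) times the quantity in [Gamma_ineq], hence nonnegative. *)
Lemma reweighted_gradient_nondecreasing :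
  {in Dom &, nondecreasing_fun reweighted_gradient}.
Proof.
pose L v := ln (Gamma v) - ln M.
pose h v := expR ((alpha - 1) * L v) * (v - kappa)
            + (dfalpha alpha \o expR) (L v).
have hE v : v \in Dom -> reweighted_gradient v = h v.
  move=> vD; rewrite /reweighted_gradient /h /=.
  have -> : Gamma v / M = expR (L v).
    by rewrite /L expRD expRN !lnK// posrE// Gamma_gt0.
  by rewrite [_ * L v]mulrC expRM.
move=> x y xD yD xy; rewrite (hE x xD) (hE y yD) -subr_ge0.
(* x or y may be an endpoint of [Dom], where the derivative is only one-sided; the mean value
   theorem asks only for continuity there. *)
have cL z : z \in `[x, y] -> L w @[w --> within `[x, y] (nbhs z)] --> L z.
  move=> zxy; apply: cvgB; last exact: cvg_cst.
  have /subspace_continuousP : {within `[x, y], continuous (fun w => ln (Gamma w))}.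
    apply: continuous_subspaceW (sub_Dom xD yD) _.
    apply: is_derivative_within_continuous => w wD.
    by exists (dlogGamma w); exact: dlogGammaE.
  exact.
have ch : {within `[x, y], continuous h}.
  apply/subspace_continuousP => z zxy.
  have cLz := cL z zxy.
  apply: cvgD.
    apply: cvgM; last by apply: cvgB; [exact: cvg_within|exact: cvg_cst].
    have : (alpha - 1) * L w @[w --> within `[x, y] (nbhs z)]
        --> (alpha - 1) * L z by apply: cvgM => //; exact: cvg_cst.
    by apply: continuous_comp_cvg; exact: continuous_expR.
  apply: continuous_comp_cvg cLz.
  apply: differentiable_continuous; apply/derivable1_diffP.
  by have [] := is_derive_dfalpha_expR alpha (L z).
pose dh z := expR ((alpha - 1) * L z)
  * (((alpha - 1) * (z - kappa) + 1) * dlogGamma z + 1).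
have hdh z : z \in `]x, y[ -> is_derive z 1 h (dh z).
  move=> zxy.
  have zD : z \in Dom by apply: (sub_Dom xD yD); exact: subset_itv_oo_cc.
  have zn : nbhs z [set` Dom].
    apply: filterS (near_in_itvoo zxy) => w wxy.
    by apply: (sub_Dom xD yD); exact: subset_itv_oo_cc.
  have dL : is_derive z 1 L (dlogGamma z).
    have := is_derivative_within_interior zn (dlogGammaE zD) => dlnG.
    by apply: is_derive_eq; rewrite subr0.
  have dd := is_derive_dfalpha_expR alpha (L z).
  have := is_derive1_comp (f := dfalpha alpha \o expR) (g := L).
  move=> /(_ _ _ _ dd dL) d1.
  rewrite /h; apply: is_derive_eq.
  by rewrite /dh /GRing.scale/=; ring.
have [z zxy ->] := MVT_segment xy hdh ch.
have zD : z \in Dom by exact: (sub_Dom xD yD).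
by rewrite mulr_ge0 ?subr_ge0// mulr_ge0 ?expR_ge0 ?Gamma_ineq.
Qed.

(** Pointwise form of Chebyshev's association inequality: 1 - Gamma v / M vanishes at v0 and is
    nondecreasing, like the gradient, so the two differences from the values at v0 have the same
    sign. *)
Lemma reweighted_gradient_anticorrelated v0 v :
    v0 \in Dom -> v \in Dom -> Gamma v0 = M ->
  (1 - Gamma v / M) * reweighted_gradient v0
    <= (1 - Gamma v / M) * reweighted_gradient v.
Proof.
move=> v0D vD Gv0; have [vv0|v0v] := leP v v0.
  apply: ler_wnM2l; last exact: reweighted_gradient_nondecreasing.
  by rewrite subr_le0 ler_pdivlMr// mul1r -Gv0 Gamma_decr.
apply: ler_wpM2l; last by apply: reweighted_gradient_nondecreasing => //; exact: ltW.
by rewrite subr_ge0 ler_pdivrMr// mul1r -Gv0 Gamma_decr// ltW.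
Qed.

(** Provides the point v0 of weight 1 at which the association inequality is centred. *)
Lemma Gamma_ivt v1 v2 : v1 \in Dom -> v2 \in Dom ->
  Gamma v1 <= M <= Gamma v2 -> exists2 v0, v0 \in Dom & Gamma v0 = M.
Proof.
wlog : v1 v2 / v2 <= v1 => [H v1D v2D GM|v21 v1D v2D GM].
  have [v21|v12] := leP v2 v1; first exact: (H v1 v2).
  (* For v1 < v2, monotonicity closes the chain Gamma v1 <= M <= Gamma v2 <= Gamma v1. *)
  exists v1 => //; apply/eqP; rewrite eq_le; case/andP: GM => -> /= GM.
  by apply: le_trans GM _; apply: Gamma_decr => //; exact: ltW.
have [||v0 v0itv Gv0] := @IVT _ Gamma v2 v1 M v21.
- exact: continuous_subspaceW (sub_Dom v2D v1D) _.
- have [G1 G2] := andP GM.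
  by rewrite ge_min le_max G1 G2 orbT.
- by exists v0 => //; exact: (sub_Dom v2D v1D).
Qed.

End reweighted_gradient.

(** * General facts on integrals, and integration against a reweighted probability *)

Section integrals.
Context {R : realType} {d : measure_display} {T : measurableType d}.
Local Open Scope ereal_scope.

(** On nonnegative reals inversion is the power -1, also at 0, where both are 0. *)
Lemma measurable_fun_inv_ge0 (f : T -> R) : measurable_fun [set: T] f ->
  (forall x, (0 <= f x)%R) -> measurable_fun [set: T] (fun x => (f x)^-1)%R.
Proof.
move=> mf f0; under eq_fun do rewrite -powR_inv1//.
exact: measurableT_comp (measurable_powR (-1)) mf.
Qed.

Lemma integrable_fin_num_integral (mu : {measure set T -> \bar R}) (f : T -> R) :
  measurable_fun [set: T] f -> \int[mu]_x (f x)%:E \is a fin_num ->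
  mu.-integrable [set: T] (EFin \o f).
Proof.
move=> mf fin; apply/integrableP; split; first exact/measurable_EFinP.
by rewrite /comp /= integral_fin_num_abs.
Qed.

(** The integral of f is at most that of its positive part, which h dominates. This serves for f of
    unknown integrability. *)
Lemma le_integral_ge0 (mu : {measure set T -> \bar R}) (f h : T -> \bar R) :
  measurable_fun [set: T] f -> measurable_fun [set: T] h ->
  (forall x, 0 <= h x) -> (forall x, f x <= h x) ->
  \int[mu]_x f x <= \int[mu]_x h x.
Proof.
move=> mf mh h0 fh; rewrite integralE.
apply: (@le_trans _ _ (\int[mu]_x f^\+ x)).
  by rewrite geeDl// oppe_le0 integral_ge0.
apply: ge0_le_integral => //; first exact: measurable_funepos.
by move=> x _; rewrite funeposE ge_max fh h0.
Qed.

(** If the integral were 0, f would vanish almost everywhere, and the whole space would be null. *)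
Lemma integral_gt0 (mu : probability T R) (f : T -> R) :
  measurable_fun [set: T] f -> (forall x, (0 < f x)%R) ->
  0 < \int[mu]_x (f x)%:E.
Proof.
move=> mf f0; have mfE : measurable_fun [set: T] (EFin \o f) by exact/measurable_EFinP.
rewrite lt0e integral_ge0 ?andbT; last by move=> x _; rewrite lee_fin ltW.
apply/eqP => if0.
have ifabs : \int[mu]_x `|(EFin \o f) x| = 0.
  by rewrite -if0; apply: eq_integral => x _; rewrite /= ger0_norm// ltW.
have [N [mN N0 NT]] := (ae_eq_integral_abs mu measurableT mfE).1 ifabs.
have : mu [set: T] <= mu N.
  apply: le_measure; rewrite ?inE// => x _; apply: NT => /= /(_ Logic.I) [].
  by apply/eqP; rewrite gt_eqF.
by rewrite [leRHS]N0 probability_setT lee_fin ler10.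
Qed.

(** Otherwise f - M or M - f would be positive everywhere with integral 0. *)
Lemma expectation_bracket (mu : probability T R) (f : T -> R) (M : R) :
    measurable_fun [set: T] f -> \int[mu]_x (f x)%:E = M%:E ->
  (exists x, f x <= M)%R /\ (exists x, M <= f x)%R.
Proof.
move=> mf fM.
have fi : mu.-integrable [set: T] (EFin \o f).
  by apply: integrable_fin_num_integral; rewrite // fM.
have iM : mu.-integrable [set: T] (EFin \o cst M).
  exact: finite_measure_integrable_cst.
have intM : \int[mu]_x (EFin \o cst M) x = M%:E.
  rewrite /comp /= integral_cst//.
  by rewrite [X in _ * X](_ : _ = 1) ?mule1//; exact: probability_setT.
split; apply/not_existsP => H.
- have := @integral_gt0 mu (fun x => f x - M)%R.
  rewrite (_ : (fun x => (f x - M)%:E) = (EFin \o f) \- (EFin \o cst M))//.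
  rewrite integralB// intM fM subee// ltxx.
  move=> /(_ _ _)/negP; apply => //; first exact: measurable_funB.
  by move=> x; rewrite subr_gt0 ltNge; exact/negP/H.
- have := @integral_gt0 mu (fun x => M - f x)%R.
  rewrite (_ : (fun x => (M - f x)%:E) = (EFin \o cst M) \- (EFin \o f))//.
  rewrite integralB// intM fM subee// ltxx.
  move=> /(_ _ _)/negP; apply => //; first exact: measurable_funB.
  by move=> x; rewrite subr_gt0 ltNge; exact/negP/H.
Qed.

Lemma integral_onem_density (mu : probability T R) (g : T -> R) :
    measurable_fun [set: T] g -> \int[mu]_x (g x)%:E = 1 ->
  mu.-integrable [set: T] (fun x => (1 - g x)%:E) /\
  \int[mu]_x (1 - g x)%:E = 0.
Proof.
move=> mg g1.
have ig : mu.-integrable [set: T] (EFin \o g).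
  by apply: integrable_fin_num_integral; rewrite // g1.
have i1 : mu.-integrable [set: T] (EFin \o cst 1%R).
  exact: finite_measure_integrable_cst.
have -> : (fun x => (1 - g x)%:E) = (EFin \o cst 1%R) \- (EFin \o g) by [].
split; first exact: integrableB.
rewrite integralB//= integral_cst// mul1e g1.
by rewrite [X in X - _](_ : _ = 1) ?subee//; exact: probability_setT.
Qed.

(** The Radon-Nikodym derivative of [reweight mu g] and g / M have the same integral over every
    measurable set, so they agree almost everywhere; a change of variables concludes. *)
Lemma integral_reweight (mu : probability T R) (g : T -> R) (h : T -> \bar R) :
    measurable_fun [set: T] g -> (forall x, (0 < g x)%R) ->
    \int[mu]_x (g x)%:E < +oo ->
    measurable_fun [set: T] h -> (forall x, 0 <= h x) ->
  \int[reweight mu g]_x h x =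
    \int[mu]_x (h x * (g x / (\int[mu]_x g x)%R)%:E).
Proof.
move=> mg g0 gfin mh h0.
set M := (\int[mu]_x g x)%R.
have gi : mu.-integrable [set: T] (EFin \o g).
  apply: integrable_fin_num_integral => //.
  by rewrite ge0_fin_numE// integral_ge0// => x _; rewrite lee_fin ltW.
have mgM : measurable_fun [set: T] (fun x => g x / M)%R by exact: measurable_funM.
have M0 : (0 <= M)%R.
  by apply: fine_ge0; rewrite integral_ge0// => x _; rewrite lee_fin ltW.
have rwE A : measurable A ->
    reweight mu g A = \int[mu]_(x in A) (g x / M)%:E.
  move=> mA; rewrite reweightE// -/M muleC -ge0_integralZl//.
  - by apply: eq_integral => x _; rewrite -EFinM mulrC.
  - by apply/measurable_EFinP; exact: measurable_funTS.
  - by move=> x _; rewrite lee_fin ltW.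
  - by rewrite lee_fin invr_ge0.
have dom : reweight mu g `<< mu.
  apply/null_content_dominatesP => A mA muA0.
  rewrite rwE// null_set_integral//.
  by apply/measurable_EFinP; exact: measurable_funTS.
rewrite -(Radon_Nikodym_SigmaFinite.change_of_variables dom)//.
apply: ae_eq_integral => //.
- apply: emeasurable_funM => //.
  exact: measurable_int (Radon_Nikodym_SigmaFinite.f_integrable dom).
- by apply: emeasurable_funM => //; exact/measurable_EFinP.
- apply: ae_eqe_mul2l.
  apply: integral_ae_eq => //.
  + exact: Radon_Nikodym_SigmaFinite.f_integrable.
  + exact/measurable_EFinP.
  + move=> E _ mE; rewrite -rwE//.
    by rewrite -Radon_Nikodym_SigmaFinite.f_integral.
Qed.

End integrals.

(** * Finiteness, positivity and measurability of the mixtures *)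

Section mixtures.
Context {R : realType} {dT dY : measure_display}
  {T : measurableType dT} {Y : measurableType dY}.
Variables (nu : {sigma_finite_measure set Y -> \bar R}).
Variables (k : T -> Y -> R) (p : Y -> R).
Hypothesis mk : measurable_fun [set: T * Y] (fun z => k z.1 z.2).
Hypothesis k_gt0 : forall theta y, 0 < k theta y.
Hypothesis k_mass : forall theta, (\int[nu]_y (k theta y)%:E = 1)%E.
Hypothesis mp : measurable_fun [set: Y] p.
Hypothesis p_gt0 : forall y, 0 < p y.
Implicit Types lam : probability T R.

Lemma measurable_kernel_l y : measurable_fun [set: T] (k ^~ y).
Proof. exact: (measurableT_comp mk (measurable_pair2 y)). Qed.

Lemma measurable_kernel_r theta : measurable_fun [set: Y] (k theta).
Proof. exact: (measurableT_comp mk (measurable_pair1 theta)). Qed.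

Let kE_ge0 (z : T * Y) : (0 <= (k z.1 z.2)%:E)%E.
Proof. by rewrite lee_fin ltW. Qed.

(** On this set the real-valued [mixture] is the true integral; elsewhere it is the default 0. *)
Definition mixture_fin lam : set Y :=
  [set y | (\int[lam]_theta (k theta y)%:E < +oo)%E].

Lemma measurable_emixture lam :
  measurable_fun [set: Y] (fun y => \int[lam]_theta (k theta y)%:E)%E.
Proof.
apply: (measurable_fun_fubini_tonelli_G (fun z => (k z.1 z.2)%:E)) => //.
exact/measurable_EFinP.
Qed.

Lemma measurable_mixture lam : measurable_fun [set: Y] (mixture lam k).
Proof.
exact: (measurableT_comp (fine_measurable measurableT) (measurable_emixture lam)).
Qed.

Lemma mixture_ge0 lam y : 0 <= mixture lam k y.
Proof. by apply: fine_ge0; apply: integral_ge0 => t _; rewrite lee_fin ltW. Qed.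

Lemma emixture_ge0 lam y : (0 <= \int[lam]_theta (k theta y)%:E)%E.
Proof. by apply: integral_ge0 => t _; rewrite lee_fin ltW. Qed.

Lemma mixture_finE lam y : mixture_fin lam y ->
  (\int[lam]_theta (k theta y)%:E = (mixture lam k y)%:E)%E.
Proof. by move=> yfin; rewrite fineK// ge0_fin_numE// emixture_ge0. Qed.

Lemma mixture_gt0 lam y : mixture_fin lam y -> 0 < mixture lam k y.
Proof.
move=> yfin; rewrite -lte_fin -mixture_finE//.
by apply: integral_gt0 => //; exact: measurable_kernel_l.
Qed.

Lemma integral_emixture lam :
  (\int[nu]_y \int[lam]_theta (k theta y)%:E = 1)%E.
Proof.
rewrite -(fubini_tonelli (fun z => (k z.1 z.2)%:E))//=; last first.
  exact/measurable_EFinP.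
under eq_integral do rewrite k_mass.
by rewrite integral_cst// mul1e; exact: probability_setT.
Qed.

Lemma measurable_mixture_fin lam : measurable (mixture_fin lam).
Proof.
rewrite -[X in measurable X]setTI.
exact: emeasurable_fun_infty_o (measurable_emixture lam) _.
Qed.

(** By Tonelli the extended mixture has integral 1, so it is finite almost everywhere. *)
Lemma mixture_fin_conull lam : nu (~` mixture_fin lam) = 0%E.
Proof.
have mi := measurable_emixture lam.
have : nu.-integrable [set: Y] (fun y => \int[lam]_theta (k theta y)%:E)%E.
  apply/integrableP; split => //.
  under eq_integral do rewrite gee0_abs ?emixture_ge0//.
  by rewrite integral_emixture ltry.
move=> /integrable_ae => /(_ measurableT)[N [mN N0 NS]].
apply/(subset_measure0 _ mN _ N0); first exact/measurableC/measurable_mixture_fin.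
move=> y /= yfin; apply: NS => /= /(_ Logic.I) fin; apply: yfin.
by rewrite /mixture_fin /= ltey_eq fin.
Qed.

(** * Restriction to a conull set, later the finiteness set of one mixture or of two *)

Section conull.
Variable Y0 : set Y.
Hypothesis mY0 : measurable Y0.
Hypothesis Y0_conull : nu (~` Y0) = 0%E.
Variables (alpha : R) (lam : probability T R).
Hypothesis Y0_fin : Y0 `<=` mixture_fin lam.

Lemma ae_eq_conull (f h : Y -> \bar R) : {in Y0, f =1 h} ->
  ae_eq nu [set: Y] f h.
Proof.
move=> fh; exists (~` Y0); split => //; first exact: measurableC.
move=> y /= + Y0y; apply => _; apply: fh; exact/mem_set.
Qed.

Lemma measurable_ratio : measurable_fun [set: Y] (fun y => mixture lam k y / p y).
Proof.
apply: measurable_funM; first exact: measurable_mixture.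
by apply: measurable_fun_inv_ge0 => // y; exact: ltW.
Qed.

Lemma PsiE : (Psi nu k p alpha lam =
  \int[nu]_y (\1_Y0 y * (falpha alpha (mixture lam k y / p y) * p y))%:E)%E.
Proof.
have mfp : measurable_fun [set: Y]
    (fun y => falpha alpha (mixture lam k y / p y) * p y).
  apply: measurable_funM => //.
  exact: measurableT_comp (measurable_falpha alpha) measurable_ratio.
apply: ae_eq_integral => //.
- exact/measurable_EFinP.
- by apply/measurable_EFinP; apply: measurable_funM.
- by apply: ae_eq_conull => y yY0; rewrite indicE yY0 mul1r.
Qed.

Lemma balphaE theta : (balpha nu k p alpha lam theta =
  \int[nu]_y (\1_Y0 y * k theta y * dfalpha alpha (mixture lam k y / p y))%:E)%E.
Proof.
have mr := measurable_ratio; have mkr := measurable_kernel_r theta.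
apply: ae_eq_integral => //.
- apply/measurable_EFinP; apply: measurable_funM => //.
  (* Where the mixture is infinite, its ratio to p is 0, and derive1 takes an
     unspecified value there. *)
  rewrite (_ : (fun y => _) = fun y => if mixture lam k y / p y == 0
      then derive1 (falpha alpha) 0 else dfalpha alpha (mixture lam k y / p y)).
    apply: measurable_fun_ifT => //.
    + exact: measurable_fun_eqr.
    + exact: measurableT_comp (measurable_dfalpha alpha) mr.
  apply/funext => y; case: eqP => [->//|/eqP u0].
  by rewrite derive1_falpha// lt0r u0 divr_ge0 ?mixture_ge0// ltW.
- apply/measurable_EFinP; apply: measurable_funM; first exact: measurable_funM.
  exact: measurableT_comp (measurable_dfalpha alpha) mr.
- apply: ae_eq_conull => y yY0; rewrite indicE yY0 mul1r derive1_falpha//.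
  by rewrite divr_gt0// mixture_gt0//; apply: Y0_fin; exact/set_mem.
Qed.

(** The integrand in closed form is jointly measurable. Its positive and negative parts are
    integrated separately, since Tonelli's theorem is about nonnegative functions. *)
Lemma measurable_balpha : measurable_fun [set: T] (balpha nu k p alpha lam).
Proof.
pose F (z : T * Y) := (\1_Y0 z.2 * k z.1 z.2
  * dfalpha alpha (mixture lam k z.2 / p z.2))%:E.
have mF : measurable_fun [set: T * Y] F.
  apply/measurable_EFinP; apply: measurable_funM; first apply: measurable_funM => //.
    have m1 : measurable_fun [set: Y] (\1_Y0 : Y -> R) by exact: measurable_indic.
    exact: measurableT_comp m1 measurable_snd.
  apply: measurableT_comp (measurable_dfalpha alpha) _.
  exact: measurableT_comp measurable_ratio measurable_snd.
rewrite (_ : balpha _ _ _ _ _ = fun theta =>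
    (\int[nu]_y F^\+ (theta, y) - \int[nu]_y F^\- (theta, y))%E); last first.
  apply/funext => theta; rewrite (balphaE theta) integralE.
  by congr (_ - _)%E; apply: eq_integral => y _; rewrite ?funeposE ?funenegE.
apply: emeasurable_funB; apply: measurable_fun_fubini_tonelli_F => //.
- exact: measurable_funepos.
- exact: measurable_funeneg.
Qed.

End conull.

End mixtures.

(** * The descent inequality for [mug], the probability of density [g] with respect to [mu] *)

Section descent.
Context {R : realType} {dT dY : measure_display}
  {T : measurableType dT} {Y : measurableType dY}.
Variables (nu : {sigma_finite_measure set Y -> \bar R}).
Variables (k : T -> Y -> R) (p : Y -> R).
Hypothesis mk : measurable_fun [set: T * Y] (fun z => k z.1 z.2).
Hypothesis k_gt0 : forall theta y, 0 < k theta y.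
Hypothesis k_mass : forall theta, (\int[nu]_y (k theta y)%:E = 1)%E.
Hypothesis mp : measurable_fun [set: Y] p.
Hypothesis p_gt0 : forall y, 0 < p y.
Variables (alpha : R) (mu mug : probability T R) (g : T -> R).
Hypothesis mg : measurable_fun [set: T] g.
Hypothesis g_gt0 : forall theta, 0 < g theta.
Hypothesis mugE : forall h : T -> \bar R,
  measurable_fun [set: T] h -> (forall theta, 0 <= h theta)%E ->
  (\int[mug]_theta h theta = \int[mu]_theta (h theta * (g theta)%:E))%E.
Hypothesis b_fin : forall theta, balpha nu k p alpha mu theta \is a fin_num.
(** In the application [c] is the gradient at the point of weight 1. As 1 - g has mean zero under
    [mu], so has the left-hand side of [anticorrelated]. *)
Variable c : R.
Hypothesis anticorrelated : forall theta, (1 - g theta) * c <=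
  (1 - g theta) * (g theta `^ (alpha - 1) * fine (balpha nu k p alpha mu theta)
                   + dfalpha alpha (g theta)).
Hypothesis Psi_fin : (Psi nu k p alpha mu < +oo)%E.

Let Y0 := mixture_fin k mu `&` mixture_fin k mug.
Let u y := mixture mu k y / p y.
Let s y := mixture mug k y / p y.
(* Outside of Y0, a mixture may be infinite and [mixture] is then 0. *)
Let w theta y := \1_Y0 y * k theta y.
Let f := falpha alpha.
Let phi := dfalpha alpha.
Let J theta y := w theta y * (phi (g theta * u y) * (1 - g theta)).
(* a1 integrates to Psi(mu), a2 to at least Psi(I mu); a3 and a4 are the positive
   and negative parts of the integrand J of A, whose integrability is not known
   beforehand; a5 is the gap of the tangent inequality. *)
Let a1 theta y := w theta y / u y * f (u y).
Let a2 theta y := w theta y / u y * f (g theta * u y).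
Let a3 theta y := Num.max (J theta y) 0.
Let a4 theta y := Num.max (- J theta y) 0.
Let a5 theta y := w theta y / u y * (f (u y) - f (g theta * u y)) - J theta y.

(** * Measurability, signs and balance of the integrands *)

Let mY0 : measurable Y0.
Proof. by apply: measurableI; exact: measurable_mixture_fin. Qed.

Let Y0_conull : nu (~` Y0) = 0%E.
Proof.
rewrite /Y0 setCI; apply/eqP; rewrite -measure_le0.
apply: le_trans (measureU2 _ _ _) _; try exact/measurableC/measurable_mixture_fin.
have n1 := mixture_fin_conull mk k_gt0 k_mass mu.
have n2 := mixture_fin_conull mk k_gt0 k_mass mug.
by rewrite [X in (X + _)%E]n1 [X in (_ + X)%E]n2 adde0.
Qed.

Let u_ge0 y : 0 <= u y.
Proof. by rewrite divr_ge0 ?mixture_ge0// ltW. Qed.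

Let u_gt0 y : Y0 y -> 0 < u y.
Proof. by move=> [y0 _]; rewrite divr_gt0// mixture_gt0. Qed.

Let s_gt0 y : Y0 y -> 0 < s y.
Proof. by move=> [_ y0]; rewrite divr_gt0// mixture_gt0. Qed.

Let w_out theta y : ~ Y0 y -> w theta y = 0.
Proof. by move=> y0; rewrite /w indicE memNset// mul0r. Qed.

Let w_in theta y : Y0 y -> w theta y = k theta y.
Proof. by move=> y0; rewrite /w indicE mem_set// mul1r. Qed.

Let mu_ : measurable_fun [set: Y] u.
Proof. exact: measurable_ratio. Qed.

Let mw : measurable_fun [set: T * Y] (fun z => w z.1 z.2).
Proof.
apply: measurable_funM => //.
have m1 : measurable_fun [set: Y] (\1_Y0 : Y -> R) by exact: measurable_indic.
exact: measurableT_comp m1 measurable_snd.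
Qed.

Let mg1 : measurable_fun [set: T * Y] (fun z => g z.1).
Proof. exact: measurableT_comp mg measurable_fst. Qed.

Let mu2 : measurable_fun [set: T * Y] (fun z => u z.2).
Proof. exact: measurableT_comp mu_ measurable_snd. Qed.

Let mgu : measurable_fun [set: T * Y] (fun z => g z.1 * u z.2).
Proof. exact: measurable_funM. Qed.

Let mfu : measurable_fun [set: T * Y] (fun z => f (u z.2)).
Proof. exact: measurableT_comp (measurable_falpha alpha) mu2. Qed.

Let mfgu : measurable_fun [set: T * Y] (fun z => f (g z.1 * u z.2)).
Proof. exact: measurableT_comp (measurable_falpha alpha) mgu. Qed.

Let mwu : measurable_fun [set: T * Y] (fun z => w z.1 z.2 / u z.2).
Proof.
apply: measurable_funM => //.
by apply: measurable_fun_inv_ge0 => // z; exact: u_ge0.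
Qed.

Let mJ : measurable_fun [set: T * Y] (fun z => J z.1 z.2).
Proof.
apply: measurable_funM => //; apply: measurable_funM; last exact: measurable_funB.
exact: measurableT_comp (measurable_dfalpha alpha) mgu.
Qed.

Let ma1 : measurable_fun [set: T * Y] (fun z => (a1 z.1 z.2)%:E).
Proof. by apply/measurable_EFinP; exact: measurable_funM. Qed.

Let ma2 : measurable_fun [set: T * Y] (fun z => (a2 z.1 z.2)%:E).
Proof. by apply/measurable_EFinP; exact: measurable_funM. Qed.

Let ma3 : measurable_fun [set: T * Y] (fun z => (a3 z.1 z.2)%:E).
Proof. by apply/measurable_EFinP; exact: measurable_maxr. Qed.

Let ma4 : measurable_fun [set: T * Y] (fun z => (a4 z.1 z.2)%:E).
Proof.
apply/measurable_EFinP; apply: measurable_maxr => //.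
exact: measurableT_comp.
Qed.

Let ma5 : measurable_fun [set: T * Y] (fun z => (a5 z.1 z.2)%:E).
Proof.
apply/measurable_EFinP; apply: measurable_funB => //; apply: measurable_funM => //.
exact: measurable_funB.
Qed.

Let a1_ge0 theta y : 0 <= a1 theta y.
Proof.
rewrite /a1; have [y0|/w_out->] := pselect (Y0 y); last by rewrite !mul0r.
rewrite w_in//; apply: mulr_ge0; first by apply: divr_ge0 => //; exact: ltW.
exact/falpha_ge0/u_gt0.
Qed.

Let a2_ge0 theta y : 0 <= a2 theta y.
Proof.
rewrite /a2; have [y0|/w_out->] := pselect (Y0 y); last by rewrite !mul0r.
rewrite w_in//; apply: mulr_ge0; first by apply: divr_ge0 => //; exact: ltW.
by apply: falpha_ge0; rewrite mulr_gt0// u_gt0.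
Qed.

Let a3_ge0 theta y : 0 <= a3 theta y.
Proof. by rewrite le_max lexx orbT. Qed.

Let a4_ge0 theta y : 0 <= a4 theta y.
Proof. by rewrite le_max lexx orbT. Qed.

(** Taking k / u out of [J] turns 1 - g into u - g u, the displacement from the point of tangency g
    u. *)
Let a5E theta y : Y0 y -> a5 theta y = k theta y / u y *
  (f (u y) - (f (g theta * u y)
              + phi (g theta * u y) * (u y - g theta * u y))).
Proof.
move=> y0; rewrite /a5 /J w_in//; field.
by rewrite gt_eqF// u_gt0.
Qed.

Let a5_gt0 theta y : Y0 y -> g theta != 1 -> 0 < a5 theta y.
Proof.
move=> y0 g1; have uy := u_gt0 y0.
rewrite a5E//; apply: mulr_gt0; first exact: divr_gt0.
rewrite subr_gt0; apply: falpha_tangent_lt => //; first exact: mulr_gt0.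
rewrite -subr_eq0 -[X in X - _]mul1r -mulrBl mulf_eq0 subr_eq0.
by rewrite eq_sym (negbTE g1) gt_eqF.
Qed.

Let a5_ge0 theta y : 0 <= a5 theta y.
Proof.
have [y0|y0] := pselect (Y0 y); last first.
  by rewrite /a5 /J w_out// !mul0r subr0.
rewrite a5E//; apply: mulr_ge0; first by apply: divr_ge0 => //; exact: ltW.
have uy := u_gt0 y0.
by rewrite subr_ge0; apply: falpha_tangent_le => //; exact: mulr_gt0.
Qed.

(** This is J = a3 - a4, arranged with nonnegative terms on both sides so that it can be integrated
    even if some integrals are infinite. *)
Let a_balance theta y : a2 theta y + a3 theta y + a5 theta y
  = a1 theta y + a4 theta y.
Proof.
have -> : a3 theta y = J theta y + a4 theta y.
  by rewrite /a3 /a4; case: (lerP (J theta y) 0); case: (lerP (- J theta y) 0); lra.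
by rewrite /a5 /a1 /a2; ring.
Qed.

(** J = a1 - a2 - a5 is at most a1. Hence the positive part of [J] has a finite integral as soon as
    Psi(mu) is finite. *)
Let a3_le_a1 theta y : a3 theta y <= a1 theta y.
Proof.
rewrite ge_max a1_ge0 andbT.
have := a5_ge0 theta y; have := a2_ge0 theta y.
by rewrite /a5 /a2 /a1; lra.
Qed.

(** * Iterated integrals of nonnegative functions of theta and y *)

Let measurable_section (a : T -> Y -> R) theta :
  measurable_fun [set: T * Y] (fun z => (a z.1 z.2)%:E) ->
  measurable_fun [set: Y] (a theta).
Proof.
move=> /measurable_EFinP ma.
exact: (measurableT_comp ma (measurable_pair1 theta)).
Qed.

Let measurable_sectionT (a : T -> Y -> R) y :
  measurable_fun [set: T * Y] (fun z => (a z.1 z.2)%:E) ->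
  measurable_fun [set: T] (a ^~ y).
Proof.
move=> /measurable_EFinP ma.
exact: (measurableT_comp ma (measurable_pair2 y)).
Qed.

Let I (a : T -> Y -> R) : \bar R := (\int[mu]_theta \int[nu]_y (a theta y)%:E)%E.

Let I_swap (a : T -> Y -> R) :
  measurable_fun [set: T * Y] (fun z => (a z.1 z.2)%:E) ->
  (forall theta y, 0 <= a theta y) ->
  (I a = \int[nu]_y \int[mu]_theta (a theta y)%:E)%E.
Proof.
move=> ma a0; rewrite /I.
by rewrite (fubini_tonelli (fun z => (a z.1 z.2)%:E))// => z; rewrite lee_fin.
Qed.

Let measurable_I (a : T -> Y -> R) :
  measurable_fun [set: T * Y] (fun z => (a z.1 z.2)%:E) ->
  (forall theta y, 0 <= a theta y) ->
  measurable_fun [set: T] (fun theta => \int[nu]_y (a theta y)%:E)%E.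
Proof.
move=> ma a0.
apply: (measurable_fun_fubini_tonelli_F (fun z => (a z.1 z.2)%:E)) => //.
by move=> z; rewrite lee_fin.
Qed.

Let I_ge0 (a : T -> Y -> R) : (forall theta y, 0 <= a theta y) -> (0 <= I a)%E.
Proof.
by move=> a0; apply: integral_ge0 => t _; apply: integral_ge0 => y _; rewrite lee_fin.
Qed.

Let I_D (a b : T -> Y -> R) :
  measurable_fun [set: T * Y] (fun z => (a z.1 z.2)%:E) ->
  measurable_fun [set: T * Y] (fun z => (b z.1 z.2)%:E) ->
  (forall theta y, 0 <= a theta y) -> (forall theta y, 0 <= b theta y) ->
  (I (fun theta y => a theta y + b theta y)%R = I a + I b)%E.
Proof.
move=> ma mb a0 b0; rewrite /I -ge0_integralD//.
- apply: eq_integral => t _; rewrite -ge0_integralD//.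
  + by move=> y _; rewrite lee_fin.
  + by apply/measurable_EFinP; exact: measurable_section.
  + by move=> y _; rewrite lee_fin.
  + by apply/measurable_EFinP; exact: measurable_section.
- by move=> t _; apply: integral_ge0 => y _; rewrite lee_fin.
- exact: measurable_I.
- by move=> t _; apply: integral_ge0 => y _; rewrite lee_fin.
- exact: measurable_I.
Qed.

(** Integrating k over theta first gives mu k, and mu k / u = p. *)
Let I_a1 : I a1 = Psi nu k p alpha mu.
Proof.
rewrite (PsiE mk k_gt0 mp p_gt0 mY0 Y0_conull) I_swap//.
apply: eq_integral => y _.
have [y0|y0] := pselect (Y0 y); last first.
  rewrite indicE memNset// mul0r integral0_eq// => t _.
  by rewrite /a1 w_out// !mul0r.
have fu0 : (0 <= f (u y) / u y) by rewrite divr_ge0 ?falpha_ge0 ?u_gt0.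
transitivity (\int[mu]_theta ((f (u y) / u y)%:E * (k theta y)%:E))%E.
  by apply: eq_integral => t _; rewrite -EFinM /a1 w_in//; congr EFin; ring.
rewrite ge0_integralZl//.
- rewrite mixture_finE//; last by case: y0.
  rewrite -EFinM indicE mem_set// mul1r; congr EFin.
  have mk0 : 0 < mixture mu k y by apply: mixture_gt0 => //; case: y0.
  rewrite /u -/f; field.
  by rewrite !gt_eqF.
- by apply/measurable_EFinP; exact: measurable_kernel_l.
- by move=> t _; rewrite lee_fin ltW.
Qed.

Let mug_mixtureE y : (\int[mug]_theta (k theta y)%:E =
  \int[mu]_theta (k theta y * g theta)%:E)%E.
Proof.
rewrite mugE//.
- by apply/measurable_EFinP; exact: measurable_kernel_l.
- by move=> t; rewrite lee_fin ltW.
Qed.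

(* Jensen's inequality for the probability measure k(., y) mu / mu k(y), by
   integrating the tangent line at [s y]. *)
Let jensen y : Y0 y ->
  ((f (s y) * p y)%:E <= \int[mu]_theta (a2 theta y)%:E)%E.
Proof.
move=> y0.
have u0 := u_gt0 y0; have s0 := s_gt0 y0; have py0 := p_gt0 y.
(* k / u times the tangent at s, evaluated at g u, is A k + B k g. As mu k = u p and mug k = s p,
   its integral over theta is f(s) p. *)
pose A := (f (s y) - phi (s y) * s y) / u y; pose B := phi (s y).
have mky := measurable_kernel_l mk y.
have mkgy : measurable_fun [set: T] (fun t => k t y * g t) by exact: measurable_funM.
have mky0 : 0 < mixture mu k y by apply: mixture_gt0 => //; case: y0.
have ik1 : (\int[mu]_theta (k theta y)%:E = (mixture mu k y)%:E)%E.
  by apply: mixture_finE => //; case: y0.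
have ikg : (\int[mu]_theta (k theta y * g theta)%:E = (mixture mug k y)%:E)%E.
  by rewrite -mug_mixtureE; apply: mixture_finE => //; case: y0.
have i1 : mu.-integrable [set: T] (EFin \o (k ^~ y)).
  by apply: integrable_fin_num_integral; rewrite // ik1.
have i2 : mu.-integrable [set: T] (EFin \o (fun t => k t y * g t)).
  by apply: integrable_fin_num_integral; rewrite // ikg.
have -> : ((f (s y) * p y)%:E = \int[mu]_theta
    (A%:E * (k theta y)%:E + B%:E * (k theta y * g theta)%:E))%E.
  rewrite integralD//; [|exact: integrableZl|exact: integrableZl].
  rewrite !integralZl// ik1 ikg -!EFinM -EFinD; congr EFin.
  rewrite /A /B /u /s; field.
  by rewrite !gt_eqF.
apply: le_integral_ge0.
- by apply: emeasurable_funD; apply: emeasurable_funM => //; exact/measurable_EFinP.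
- by apply/measurable_EFinP; exact: measurable_sectionT.
- by move=> t; rewrite lee_fin.
- move=> t; rewrite -!EFinM -EFinD lee_fin /a2 w_in//.
  have ku0 : 0 <= k t y / u y by rewrite divr_ge0 ?ltW.
  have := @falpha_tangent_le R alpha (g t * u y) (s y).
  move=> /(_ (mulr_gt0 (g_gt0 t) u0) s0) /(ler_wpM2l ku0).
  apply: le_trans; rewrite le_eqVlt; apply/orP; left; apply/eqP.
  rewrite /A /B /f /phi; field.
  by rewrite gt_eqF.
Qed.

Let Psi_le_I_a2 : (Psi nu k p alpha mug <= I a2)%E.
Proof.
rewrite (PsiE mk k_gt0 mp p_gt0 mY0 Y0_conull) I_swap//.
have int_a2_ge0 y : (0 <= \int[mu]_theta (a2 theta y)%:E)%E.
  by apply: integral_ge0 => t _; rewrite lee_fin.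
apply: le_integral_ge0 => //.
- apply/measurable_EFinP; apply: measurable_funM => //; apply: measurable_funM => //.
  apply: measurableT_comp (measurable_falpha alpha) _.
  exact: measurable_ratio.
- apply: (measurable_fun_fubini_tonelli_G (fun z => (a2 z.1 z.2)%:E)) => //.
  by move=> z; rewrite lee_fin.
- move=> y; rewrite indicE; have [y0|y0] := pselect (Y0 y).
    by rewrite mem_set// mul1r; exact: jensen.
  by rewrite memNset// mul0r.
Qed.

(** By [dfalphaM], this is the integral over y of k f'(g u). *)
Let gradient theta := g theta `^ (alpha - 1) * fine (balpha nu k p alpha mu theta)
  + phi (g theta).

Let mw_r theta : measurable_fun [set: Y] (w theta).
Proof. by apply: measurable_section; exact/measurable_EFinP. Qed.

Let integral_w theta : (\int[nu]_y (w theta y)%:E = 1)%E.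
Proof.
rewrite -(k_mass theta); apply: ae_eq_integral => //.
- exact/measurable_EFinP.
- by apply/measurable_EFinP; exact: measurable_kernel_r.
- apply: (ae_eq_conull mY0 Y0_conull) => y yY0.
  by rewrite w_in//; exact/set_mem.
Qed.

(** By [dfalphaM], [J theta] is a linear combination of w f'(u), integrable because b is finite, and
    of w, which has mass 1. *)
Let integrable_J theta : nu.-integrable [set: Y] (EFin \o J theta) /\
  (\int[nu]_y (J theta y)%:E = ((1 - g theta) * gradient theta)%:E)%E.
Proof.
pose wphi y := w theta y * phi (u y).
have mwphi : measurable_fun [set: Y] wphi.
  apply: measurable_funM => //.
  exact: measurableT_comp (measurable_dfalpha alpha) mu_.
have intb : (\int[nu]_y (wphi y)%:E = (fine (balpha nu k p alpha mu theta))%:E)%E.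
  rewrite fineK// (balphaE mk k_gt0 mp p_gt0 mY0 Y0_conull)//.
  exact: subIsetl.
have i1 : nu.-integrable [set: Y] (EFin \o wphi).
  by apply: integrable_fin_num_integral; rewrite // intb.
have i2 : nu.-integrable [set: Y] (EFin \o w theta).
  by apply: integrable_fin_num_integral; rewrite // integral_w.
pose A := (1 - g theta) * g theta `^ (alpha - 1).
pose B := (1 - g theta) * phi (g theta).
have JE : EFin \o J theta =
    (fun y => A%:E * (wphi y)%:E + B%:E * (w theta y)%:E)%E.
  apply/funext => y; rewrite /= -!EFinM -EFinD; congr EFin.
  rewrite /J /wphi; have [y0|y0] := pselect (Y0 y); last first.
    by rewrite w_out// !mul0r !mulr0 addr0.
  by rewrite /A /B /phi dfalphaM ?u_gt0//; ring.
have iA := integrableZl measurableT A i1.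
have iB := integrableZl measurableT B i2.
split; first by rewrite JE; exact: integrableD.
rewrite -[LHS]/(\int[nu]_y (EFin \o J theta) y)%E JE integralD//.
rewrite !integralZl// intb integral_w -!EFinM -EFinD /A /B /gradient.
by congr EFin; ring.
Qed.

Let integral_a34 theta : exists x3 x4 : R,
  [/\ (\int[nu]_y (a3 theta y)%:E = x3%:E)%E,
      (\int[nu]_y (a4 theta y)%:E = x4%:E)%E &
      x3 - x4 = (1 - g theta) * gradient theta].
Proof.
have [iJ intJ] := integrable_J theta.
have e3 : (EFin \o J theta)^\+%E = EFin \o a3 theta.
  by apply/funext => y; rewrite funeposE /= -EFin_max.
have e4 : (EFin \o J theta)^\-%E = EFin \o a4 theta.
  by apply/funext => y; rewrite funenegE /= -EFin_max.
have f3 := integrable_pos_fin_num measurableT iJ.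
have f4 := integrable_neg_fin_num measurableT iJ.
move: intJ; rewrite -[X in X = _]/(\int[nu]_y (EFin \o J theta) y)%E integralE.
rewrite e3 e4 in f3 f4 *.
rewrite -(fineK f3) -(fineK f4) => -[E].
by eexists; eexists; split; [rewrite -(fineK f3)|rewrite -(fineK f4)|exact: E].
Qed.

Let g_mass : (\int[mu]_theta (g theta)%:E = 1)%E.
Proof.
have := @mugE (cst 1%E) (measurable_cst _) (fun=> lee01).
rewrite integral_cst// mul1e => mug1.
transitivity (\int[mu]_theta (cst 1 theta * (g theta)%:E))%E.
  by apply: eq_integral => t _; rewrite mul1e.
by rewrite -mug1; exact: probability_setT.
Qed.

(** * Sign of the correlation term, descent, and the case of equality *)

Let I_a3_fin : (I a3 < +oo)%E.
Proof.
apply: le_lt_trans Psi_fin; rewrite -I_a1.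
apply: ge0_le_integral => //.
- by move=> t _; apply: integral_ge0 => y _; rewrite lee_fin.
- exact: measurable_I.
- exact: measurable_I.
move=> t _; apply: ge0_le_integral => //.
- by move=> y _; rewrite lee_fin.
- by apply/measurable_EFinP; exact: measurable_section.
- by apply/measurable_EFinP; exact: measurable_section.
- by move=> y _; rewrite lee_fin.
Qed.

(** This is A >= 0. For each theta the integral of a4 is at most that of a3 minus (1 - g) c, and the
    last term has mean zero. *)
Let I_a4_le_a3 : (I a4 <= I a3)%E.
Proof.
have i3 : mu.-integrable [set: T] (fun theta => \int[nu]_y (a3 theta y)%:E)%E.
  apply/integrableP; split; first exact: measurable_I.
  rewrite [ltLHS](_ : _ = I a3)//; apply: eq_integral => t _.
  by rewrite gee0_abs// integral_ge0// => y _; rewrite lee_fin.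
pose h theta := (1 - g theta) * c.
have mh : measurable_fun [set: T] h.
  by apply: measurable_funM => //; exact: measurable_funB.
have [i1g int1g] := integral_onem_density mg g_mass.
have hE : EFin \o h = (fun t => c%:E * (1 - g t)%:E)%E.
  by apply/funext => t; rewrite /= -EFinM /h mulrC.
have ih : mu.-integrable [set: T] (EFin \o h).
  by rewrite hE; exact: integrableZl.
have inth : (\int[mu]_t (EFin \o h) t = 0)%E.
  by rewrite hE integralZl// int1g mule0.
rewrite -[leRHS]sube0 -inth /I -integralB//.
apply: ge0_le_integral => //.
- by move=> t _; apply: integral_ge0 => y _; rewrite lee_fin.
- exact: measurable_I.
- apply: emeasurable_funB; first exact: measurable_I.
  exact/measurable_EFinP.
move=> t _; have [x3 [x4 [E3 E4 E]]] := integral_a34 t.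
rewrite /= E3 E4 -EFinB lee_fin /h.
by have := anticorrelated t; rewrite -/(gradient t); lra.
Qed.

Let Psi_I_a5 : (Psi nu k p alpha mug + I a5 <= Psi nu k p alpha mu)%E.
Proof.
have bal : (I a2 + I a3 + I a5 = I a1 + I a4)%E.
  have m23 : measurable_fun [set: T * Y]
      (fun z => (a2 z.1 z.2 + a3 z.1 z.2)%:E).
    by under eq_fun do rewrite EFinD; exact: emeasurable_funD.
  have a23_ge0 t y : 0 <= a2 t y + a3 t y by rewrite addr_ge0.
  have e23 := I_D ma2 ma3 a2_ge0 a3_ge0.
  have e235 := I_D m23 ma5 a23_ge0 a5_ge0.
  apply: (etrans _ (I_D ma1 ma4 a1_ge0 a4_ge0)).
  apply: (etrans (congr1 (fun x => x + I a5)%E (esym e23))).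
  apply: (etrans (esym e235)).
  by apply: eq_integral => t _; apply: eq_integral => y _; rewrite a_balance.
apply: (le_trans (leeD2r (I a5) Psi_le_I_a2)).
(* Adding the finite [I a3] to both sides makes the left one I a1 + I a4, so that no possibly
   infinite term is subtracted. *)
have a3fin : I a3 \is a fin_num by rewrite ge0_fin_numE ?(I_ge0 a3_ge0).
rewrite -(leeD2rE _ _ a3fin) addeAC bal I_a1.
exact: leeD2l I_a4_le_a3.
Qed.

Lemma Psi_decreases : (Psi nu k p alpha mug <= Psi nu k p alpha mu)%E.
Proof. exact: le_trans (leeDl _ (I_ge0 a5_ge0)) Psi_I_a5. Qed.

Lemma Psi_eq_weight1 : Psi nu k p alpha mug = Psi nu k p alpha mu ->
  ae_eq mu [set: T] (EFin \o g) (cst 1%E).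
Proof.
move=> Psi_eq.
have Psi0 : (0 <= Psi nu k p alpha mu)%E by rewrite -I_a1 I_ge0.
(* The finite Psi(mu) cancels in [Psi_I_a5]. *)
have I50 : I a5 = 0%E.
  have Pfin : Psi nu k p alpha mu \is a fin_num by rewrite ge0_fin_numE.
  apply/eqP; rewrite eq_le I_ge0// andbT.
  have := Psi_I_a5; rewrite Psi_eq -[X in (_ <= X)%E]adde0 leeD2lE//.
have mI5 := measurable_I ma5 a5_ge0.
have : ae_eq mu [set: T] (fun t => \int[nu]_y (a5 t y)%:E)%E (cst 0%E).
  apply/ae_eq_integral_abs => //; rewrite -I50.
  by apply: eq_integral => t _; rewrite gee0_abs// integral_ge0// => y _; rewrite lee_fin.
apply: filterS => t /= /(_ Logic.I) i0 _; congr EFin; apply/eqP/negP => /negP g1.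
have ma5t : measurable_fun [set: Y] (EFin \o a5 t).
  by apply/measurable_EFinP; exact: measurable_section.
have : ae_eq nu [set: Y] (EFin \o a5 t) (cst 0%E).
  apply/ae_eq_integral_abs => //; rewrite -i0.
  by apply: eq_integral => y _; rewrite gee0_abs// lee_fin.
(* With g t != 1 the gap a5 is positive on [Y0], so its vanishing almost everywhere forces w t = 0
   almost everywhere, against its mass 1. *)
move=> a50; have : ae_eq nu [set: Y] (EFin \o w t) (cst 0%E).
  apply: filterS a50 => y /= /(_ Logic.I)-[a5y] _; congr EFin.
  apply: contrapT => /eqP wy; have [y0|y0] := pselect (Y0 y).
    by have := a5_gt0 y0 g1; rewrite a5y ltxx.
  by move: wy; rewrite w_out// eqxx.
move=> w0; have : (\int[nu]_y (EFin \o w t) y = \int[nu]_y cst 0 y)%E.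
  by apply: ae_eq_integral => //; exact/measurable_EFinP.
by rewrite integral0 [LHS]integral_w => /eqP; rewrite eqe oner_eq0.
Qed.

End descent.

Theorem theorem1 (R : realType) (dT dY : measure_display)
    (T : measurableType dT) (Y : measurableType dY)
    (nu : {sigma_finite_measure set Y -> \bar R})
    (k : T -> Y -> R) (K : R.-pker T ~> Y) (p : Y -> R)
    (mk : measurable_fun [set: T * Y] (fun z => k z.1 z.2))
    (kK : forall theta (A : set Y), measurable A ->
       K theta A = (\int[nu]_(y in A) (k theta y)%:E)%E)
    (k_gt0 : forall theta y, 0 < k theta y)
    (mp : measurable_fun [set: Y] p)
    (p_gt0 : forall y, 0 < p y)
    (p_fin : (\int[nu]_y (p y)%:E < +oo)%E)
    (alpha kappa : R)
    (b1_fin : alpha = 1 -> forall (mu : probability T R) (theta : T),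
       balpha nu k p alpha mu theta \is a fin_num)
    (Dom : interval R)
    (Dom_b : forall (mu : probability T R) (theta : T),
       (EFin @` [set` Dom]) (balpha nu k p alpha mu theta + kappa%:E)%E)
    (Dom_mub : forall mu : probability T R,
       (EFin @` [set` Dom])
         (\int[mu]_theta (balpha nu k p alpha mu theta) + kappa%:E)%E)
    (Gamma dlogGamma : R -> R)
    (Gamma_gt0 : forall v, v \in Dom -> 0 < Gamma v)
    (Gamma_decr : {in Dom &, nonincreasing_fun Gamma})
    (Gamma_C1 : C1_on [set` Dom] Gamma)
    (dlogGammaE : forall v, v \in Dom ->
       is_derivative_within [set` Dom] (fun w => ln (Gamma w)) v (dlogGamma v))
    (Gamma_ineq : forall v, v \in Dom ->
       0 <= ((alpha - 1) * (v - kappa) + 1) * dlogGamma v + 1)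
    (mu : probability T R)
    (muGamma_fin :
       (\int[mu]_theta
          (Gamma (fine (balpha nu k p alpha mu theta) + kappa))%:E < +oo)%E)
    (Psi_fin : (Psi nu k p alpha mu < +oo)%E) :
  let Imu := Ialpha nu k p alpha kappa Gamma mu in
  (Psi nu k p alpha Imu <= Psi nu k p alpha mu)%E /\
  (Psi nu k p alpha Imu = Psi nu k p alpha mu <->
   forall A : set T, measurable A -> mu A = Imu A).
Proof.
move=> Imu.
have k_mass theta : (\int[nu]_y (k theta y)%:E = 1)%E.
  by rewrite -kK//; exact: prob_kernel.
have b_fin theta : balpha nu k p alpha mu theta \is a fin_num.
  have [v _ /(congr1 (fun x => x - kappa%:E)%E)] := Dom_b mu theta.
  by rewrite addeK// => <-.
pose V theta := fine (balpha nu k p alpha mu theta) + kappa.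
have V_Dom theta : V theta \in Dom.
  have [v vD] := Dom_b mu theta.
  by rewrite -(fineK (b_fin theta)) -EFinD => -[vE]; rewrite /V -vE.
have Gamma_cont : {within [set` Dom], continuous Gamma}.
  have [dGamma dGammaE _] := Gamma_C1.
  by apply: is_derivative_within_continuous => v vD; exists (dGamma v); exact: dGammaE.
pose G theta := Gamma (V theta).
have G_gt0 theta : 0 < G theta by exact: Gamma_gt0.
have mV : measurable_fun [set: T] V.
  apply: measurable_funD => //.
  apply: measurableT_comp (fine_measurable measurableT) _.
  apply: (@measurable_balpha _ _ _ _ _ nu k p mk k_gt0 mp p_gt0 (mixture_fin k mu)) => //.
  - exact: measurable_mixture_fin.
  - exact: mixture_fin_conull.
(* [Gamma] is continuous relative to [Dom], an interval containing all values of V. *)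
have mG : measurable_fun [set: T] G.
  apply: (measurable_comp (F := [set` Dom])) => //.
  - by move=> _ [theta _ <-]; exact: V_Dom.
  - exact: subspace_continuous_measurable_fun.
pose M := (\int[mu]_theta G theta)%R.
have GM : (\int[mu]_theta (G theta)%:E = M%:E)%E.
  rewrite fineK// ge0_fin_numE//.
  by apply: integral_ge0 => theta _; rewrite lee_fin ltW.
have M_gt0 : 0 < M by rewrite -lte_fin -GM; exact: integral_gt0.
(* Two values of G bracket its mean M, so the intermediate value theorem yields v0 in [Dom] with
   Gamma v0 = M. *)
have [[t1 G1] [t2 G2]] := expectation_bracket mG GM.
have [|v0 v0D Gv0] := Gamma_ivt Gamma_decr Gamma_cont (V_Dom t1) (V_Dom t2) (M := M).
  by apply/andP.
pose g theta := G theta / M.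
have mg : measurable_fun [set: T] g by exact: measurable_funM.
have g_gt0 theta : 0 < g theta by rewrite divr_gt0.
have ImuE h : measurable_fun [set: T] h -> (forall theta, 0 <= h theta)%E ->
    (\int[Imu]_theta h theta = \int[mu]_theta (h theta * (g theta)%:E))%E.
  by move=> mh h0; exact: integral_reweight.
have anticorr theta : (1 - g theta) * reweighted_gradient alpha kappa Gamma M v0 <=
    (1 - g theta) * (g theta `^ (alpha - 1) * fine (balpha nu k p alpha mu theta)
                     + dfalpha alpha (g theta)).
  have := reweighted_gradient_anticorrelated Gamma_gt0 Gamma_decr dlogGammaE
    Gamma_ineq M_gt0 v0D (V_Dom theta) Gv0.
  by rewrite {2}/reweighted_gradient [V theta - kappa]addrK.
split; first exact: (Psi_decreases mk k_gt0 k_mass mp p_gt0 mg g_gt0 ImuE b_fin anticorr).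
split=> [Psi_eq A mA|muE].
- have g1 := Psi_eq_weight1 mk k_gt0 k_mass mp p_gt0 mg g_gt0 ImuE b_fin
    anticorr Psi_fin Psi_eq.
  (* The measure of A under [Imu] is the integral of its indicator times g under [mu], and g = 1
     almost everywhere. *)
  rewrite -[A]setIT -[LHS](integral_indic mu)// -[RHS](integral_indic Imu)//.
  have m1 : measurable_fun [set: T] (fun x => (\1_A x : R)%:E).
    by apply/measurable_EFinP; exact: measurable_indic.
  rewrite ImuE//; apply: ae_eq_integral => //.
    by apply: emeasurable_funM => //; exact/measurable_EFinP.
  by apply: filterS g1 => x /= /(_ Logic.I) -> _; rewrite mule1.
(* Psi depends on the probability only through its mixture. *)
- have mixE : mixture Imu k = mixture mu k.
    apply/funext => y; congr fine; apply: eq_measure_integral => A mA _.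
    exact/esym/muE.
  by rewrite /Psi mixE.
Qed.
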